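(* A finite tree is determined up to isomorphism by its weighted orbit quotient. That is, if $T$ and $T'$ are finite trees with weighted orbit quotients $(s_i,b_{ij})_{1\le i,j\le m}$ and $(s'_i,b'_{ij})_{1\le i,j\le m'}$, and if $m=m'$ and there is a permutation $\pi$ of $\{1,\dots,m\}$ with $s'_{\pi(i)}=s_i$ and $b'_{\pi(i)\pi(j)}=b_{ij}$ for all $i,j$, then $T\cong T'$.
   Context: For a finite simple graph $G$ with adjacency matrix $A$, let $O_1,\dots,O_m$ be the orbits of $\operatorname{Aut}(G)$ on vertices and $u_i=\mathbf 1_{O_i}$ their indicator vectors. Put $s_i=u_i^Tu_i=|O_i|$, $q_{ij}=u_i^TAu_j$ and $b_{ij}=q_{ij}/s_i$; thus $b_{ij}$ is the number of neighbors in $O_j$ of any fixed vertex of $O_i$. The weighted orbit quotient of $G$ is the data $(s_i,b_{ij})_{1\le i,j\le m}$, considered up to simultaneous relabeling of the indices (diagonal entries $b_{ii}$ are allowed to be nonzero). *)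

(* Defs.v *)
From HB Require Import structures.
From mathcomp Require Import all_boot all_order all_algebra all_fingroup.
Set Implicit Arguments. Unset Strict Implicit. Unset Printing Implicit Defensive.
Import GRing.Theory.
Local Open Scope ring_scope.

Record sgraph := SGraph {
  vertex :> finType;
  edge : rel vertex;
  edge_sym : symmetric edge;
  edge_irrefl : irreflexive edge }.

Definition connected_graph (G : sgraph) : Prop :=
  (0 < #|vertex G|)%N /\ forall x y : G, connect (@edge G) x y.

(* The bound on the size is needed because [:: x; y] is a ucycle for every
   edge xy. *)
Definition acyclic (G : sgraph) : Prop :=
  forall p : seq G, (2 < size p)%N -> ~ ucycle (@edge G) p.

Definition is_tree (G : sgraph) : Prop := connected_graph G /\ acyclic G.

Definition isomorphic (G H : sgraph) : Prop :=
  exists2 f : G -> H, bijective f & {mono f : x y / edge x y}.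

Definition graph_aut (G : sgraph) : {set {perm G}} :=
  [set s : {perm G} | [forall x, forall y, edge (s x) (s y) == edge x y]].

Lemma graph_aut_group_set (G : sgraph) : group_set (graph_aut G).
Proof.
apply/group_setP; split.
  by rewrite inE; apply/forallP => x; apply/forallP => y; rewrite !perm1.
move=> s t; rewrite !inE => /forallP hs /forallP ht.
apply/forallP => x; apply/forallP => y; rewrite !permM.
by rewrite (eqP (forallP (ht _) _)) (eqP (forallP (hs _) _)).
Qed.

Canonical graph_aut_group (G : sgraph) := Group (graph_aut_group_set G).

Definition graph_orbits (G : sgraph) : {set {set G}} :=
  orbit 'P (graph_aut G) @: [set: G].

Definition orbit_enumeration (G : sgraph) (m : nat) (O : 'I_m -> {set G}) :
    Prop :=
  injective O /\ [set O i | i : 'I_m] = graph_orbits G.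

(* Rows and columns are indexed by the vertices through [enum_val]. *)
Definition adjmx (G : sgraph) : 'M[rat]_#|vertex G| :=
  \matrix_(i, j) (edge (enum_val i) (enum_val j))%:R.

Definition indicator (G : sgraph) (X : {set G}) : 'cV[rat]_#|vertex G| :=
  \col_i (enum_val i \in X)%:R.

(* For an enumeration O_1, ..., O_m of the orbits, s_i, q_ij and b_ij are
   [orbit_weight (O i)], [orbit_form (O i) (O j)] and
   [orbit_coef (O i) (O j)]; the 1 x 1 products are read as scalars. *)
Definition orbit_weight (G : sgraph) (X : {set G}) : rat :=
  ((indicator X)^T *m indicator X) 0 0.

Definition orbit_form (G : sgraph) (X Y : {set G}) : rat :=
  ((indicator X)^T *m adjmx G *m indicator Y) 0 0.

Definition orbit_coef (G : sgraph) (X Y : {set G}) : rat :=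
  orbit_form X Y / orbit_weight X.

(* Main.v *)
Require Import Defs.
From HB Require Import structures.
From mathcomp Require Import all_boot all_order all_algebra all_fingroup.

(** The entry b_ij counts the neighbours in O_j of any vertex of O_i
    ([orbit_coefE]).  Colour each vertex by the index of its orbit, the indices
    of the two trees being identified by pi: vertices of the same colour, taken
    from either tree, then see the same number of neighbours of each colour
    ([same_local_counts]).  A tree is its own universal cover, hence it is
    recovered from such local data: starting from two vertices of the same
    colour, an isomorphism is grown one vertex at a time.

    A stage of the construction is a set of pairs in T * T' that is the graph of
    a colour-preserving isomorphism between connected induced subgraphs.  If a
    vertex y outside the domain is adjacent to a matched x, then, by counting,
    the partner of x also has an unmatched neighbour y' of the colour of y
    ([unmatched_neighbour]).  Matching y with y' preserves and reflects edges
    because, in an acyclic graph, a vertex outside a connected set has at most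
    one neighbour in it ([acyclic_attach_uniq]).  Enlarging a matching as long as
    possible therefore ends with one defined on the whole of T, which is an
    embedding of T into T' ([tree_embedding]); the hypotheses being symmetric, T'
    also embeds into T, so both trees have the same size and the embedding is an
    isomorphism. *)

Set Implicit Arguments. Unset Strict Implicit. Unset Printing Implicit Defensive.
Import GRing.Theory Num.Theory.

(** * Matching two trees with the same local colour counts *)

Definition nbrs (G : sgraph) (x : G) (X : {pred G}) : {set G} :=
  [set y in X | edge x y].

Definition same_local_counts (I : eqType) (T T' : sgraph) (c : T -> I)
    (c' : T' -> I) : Prop :=
  forall x x', c x = c' x' -> forall j : I,
    #|nbrs x [pred y | c y == j]| = #|nbrs x' [pred y | c' y == j]|.

(** Otherwise y, together with a simple path joining its two neighbours, forms a
    cycle. *)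
Lemma acyclic_attach_uniq (G : sgraph) (x y : G) (p : seq G) :
  acyclic G -> path (@edge G) x p -> y \notin x :: p ->
  edge y x -> edge y (last x p) -> x = last x p.
Proof.
move=> acG xp; case/shortenP: xp => q xq uq sub_qp yNxp yx yq.
have yNxq : y \notin x :: q.
  apply: contra yNxp; rewrite !inE => /orP[-> //|/sub_qp ->]; exact: orbT.
case: q xq uq sub_qp yq yNxq => [//|z q] xq uq _ yq yNxq.
case: (acG [:: y, x, z & q]) => //.
apply/andP; split; last by rewrite cons_uniq yNxq.
move: xq yq; rewrite /= rcons_path yx [edge y (last _ _)]edge_sym.
by move=> /andP[-> ->] ->.
Qed.

Lemma connected_exit (G : sgraph) (D : {pred G}) (x0 z : G) :
  connected_graph G -> x0 \in D -> z \notin D ->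
  exists x y, [/\ x \in D, y \notin D & edge x y].
Proof.
case=> _ /(_ x0 z) /connectP[p + ->]; elim: p x0 => [|y p IHp] x /=.
  by move=> _ ->.
case/andP=> xy yp xD; have [yD|yND] := boolP (y \in D); first exact: IHp.
by move=> _; exists x, y.
Qed.

Section Matching.

Variables (I : eqType) (T T' : sgraph) (c : T -> I) (c' : T' -> I).

Implicit Types (R : {set T * T'}) (p q : T * T').

Definition link R : rel (T * T') :=
  [rel p q | [&& p \in R, q \in R & edge p.1 q.1]].

Record matching R : Prop := Matching {
  match_eq : {in R &, forall p q, (p.1 == q.1) = (p.2 == q.2)};
  match_edge : {in R &, forall p q, edge p.1 q.1 = edge p.2 q.2};
  match_col : {in R, forall p, c p.1 = c' p.2};
  match_conn : {in R &, forall p q, connect (link R) p q} }.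

Lemma link_sym R : symmetric (link R).
Proof.
by move=> p q; rewrite /link /= edge_sym; case: (p \in R); case: (q \in R).
Qed.

Lemma matching1 x x' : c x = c' x' -> matching [set (x, x')].
Proof.
move=> cx; split=> [p q|p q|p|p q]; rewrite !inE.
- by move=> /eqP-> /eqP->; rewrite !eqxx.
- by move=> /eqP-> /eqP->; rewrite /= !edge_irrefl.
- by move/eqP->.
- by move=> /eqP-> /eqP->; apply: connect0.
Qed.

(** If all neighbours of x' of the colour of y were matched, their partners
    would be as many neighbours of x of that colour, all different from y. *)
Lemma unmatched_neighbour R x x' y :
  same_local_counts c c' -> matching R -> (x, x') \in R ->
  y \notin [set p.1 | p in R] -> edge x y ->
  exists y', [/\ y' \notin [set p.2 | p in R], edge x' y' & c y = c' y'].
Proof.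
move=> cnt [Req Redge Rcol _] xR yN xy.
set N := nbrs x [pred z | c z == c y].
set N' := nbrs x' [pred z | c' z == c y].
have eqN : #|N| = #|N'| by apply: cnt; apply: (Rcol _ xR).
have [|/subsetPn[y']] := boolP (N' \subset [set p.2 | p in R]); last first.
  by rewrite !inE => /andP[/eqP cy' xy'] y'N; exists y'.
move=> N'R; pose P := [set p in R | p.1 \in N].
have N'P : N' \subset [set p.2 | p in P].
  apply/subsetP => z' z'N; have /imsetP[p pR z'E] := subsetP N'R _ z'N.
  apply/imsetP; exists p => //; rewrite !inE pR /= (Rcol _ pR) -z'E.
  move: z'N; rewrite !inE => /andP[-> xz'].
  by rewrite (Redge _ _ xR pR) -z'E.
have PN : [set p.1 | p in P] \proper N.
  apply/properP; split.
    by apply/subsetP => z /imsetP[p + ->]; rewrite inE => /andP[].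
  exists y; first by rewrite !inE eqxx.
  apply: contra yN => /imsetP[p + ->]; rewrite inE => /andP[pR _].
  exact: imset_f.
have inj1 : {in P &, injective fst}.
  move=> p q; rewrite !inE => /andP[pR _] /andP[qR _] pq.
  have /eqP pq2 : p.2 == q.2 by rewrite -Req // pq.
  by rewrite [p]surjective_pairing [q]surjective_pairing pq pq2.
have := leq_trans (subset_leq_card N'P) (leq_imset_card _ _).
by rewrite -(card_in_imset inj1) leqNgt -eqN (proper_card PN).
Qed.

(** The domain and the codomain of a matching are connected, so y and y' have no
    neighbour there besides x and x'. *)
Lemma matching_extend R x x' y y' :
  acyclic T -> acyclic T' -> matching R -> (x, x') \in R ->
  y \notin [set p.1 | p in R] -> y' \notin [set p.2 | p in R] ->
  edge x y -> edge x' y' -> c y = c' y' -> matching ((y, y') |: R).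
Proof.
move=> acT acT' [Req Redge Rcol Rconn] xR yN y'N xy x'y' cy.
have neq1 p : p \in R -> (y == p.1) = false.
  by move=> pR; apply: contraNF yN => /eqP ->; apply: imset_f.
have neq2 p : p \in R -> (y' == p.2) = false.
  by move=> pR; apply: contraNF y'N => /eqP ->; apply: imset_f.
have walk p : p \in R -> exists s, [/\ path (link R) (x, x') s,
    p = last (x, x') s & {subset (x, x') :: s <= R}].
  move=> pR; have /connectP[s ps ->] := Rconn _ _ xR pR.
  exists s; split=> // q; rewrite inE => /predU1P[-> //|].
  elim: s (x, x') ps => //= a s IHs b /andP[/and3P[_ aR _] /IHs h].
  by rewrite inE => /predU1P[->|/h].
have edge1 p : p \in R -> edge y p.1 = (p.1 == x).
  move=> pR; apply/idP/eqP => [yp|->]; last by rewrite edge_sym.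
  have [s [xs pE sR]] := walk p pR.
  have lastE : last x (map fst s) = p.1 by rewrite pE (last_map fst s (x, x')).
  rewrite -lastE; apply/esym/(@acyclic_attach_uniq _ x y) => //.
  - rewrite (@path_map _ _ fst _ (x, x')).
    by apply: sub_path xs => a b /and3P[].
  - rewrite -[x :: _]/(map fst ((x, x') :: s)).
    by apply: contra yN => /mapP[q /sR qR ->]; apply: imset_f.
  - by rewrite edge_sym.
  - by rewrite lastE.
have edge2 p : p \in R -> edge y' p.2 = (p.2 == x').
  move=> pR; apply/idP/eqP => [yp|->]; last by rewrite edge_sym.
  have [s [xs pE sR]] := walk p pR.
  have lastE : last x' (map snd s) = p.2 by rewrite pE (last_map snd s (x, x')).
  rewrite -lastE; apply/esym/(@acyclic_attach_uniq _ x' y') => //.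
  - rewrite (@path_map _ _ snd _ (x, x')).
    by apply: sub_path xs => a b /and3P[aR bR]; rewrite /= Redge.
  - rewrite -[x' :: _]/(map snd ((x, x') :: s)).
    by apply: contra y'N => /mapP[q /sR qR ->]; apply: imset_f.
  - by rewrite edge_sym.
  - by rewrite lastE.
have edge12 p : p \in R -> edge y p.1 = edge y' p.2.
  by move=> pR; rewrite edge1 // edge2 // (Req p (x, x')).
split=> [p q|p q|p|].
- move=> /setU1P[->|pR] /setU1P[->|qR] /=; rewrite ?eqxx //.
  + by rewrite neq1 // neq2.
  + by rewrite ![_ == y]eq_sym ![_ == y']eq_sym neq1 // neq2.
  + exact: Req.
- move=> /setU1P[->|pR] /setU1P[->|qR] /=; rewrite ?edge_irrefl //.
  + exact: edge12.
  + by rewrite ![edge p.1 _]edge_sym ![edge p.2 _]edge_sym edge12.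
  + exact: Redge.
- by move=> /setU1P[->|pR] //; apply: Rcol.
have csym := sym_connect_sym (@link_sym ((y, y') |: R)).
have from_x p : p \in (y, y') |: R -> connect (link ((y, y') |: R)) (x, x') p.
  case/setU1P=> [->|pR].
    by apply: connect1; rewrite /link /= !inE xR xy eqxx orbT.
  apply: connect_sub (Rconn _ _ xR pR) => a b /and3P[aR bR ab].
  by apply: connect1; rewrite /link /= !inE aR bR ab !orbT.
by move=> p q pR qR; apply: connect_trans (from_x q qR); rewrite csym from_x.
Qed.

(** A matching that misses a vertex of T can always be enlarged, which cannot go
    on beyond the size of T * T'. *)
Lemma tree_embedding x0 x0' :
  is_tree T -> acyclic T' -> same_local_counts c c' -> c x0 = c' x0' ->
  exists2 f : T -> T', injective f & {mono f : x y / edge x y}.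
Proof.
move=> [connT acT] acT' cnt c0.
suff [R [Req Redge _ _] Rdom] : exists2 R, matching R &
    forall x, x \in [set p.1 | p in R].
  have partner x : {x' | (x, x') \in R}.
    apply/sigW; have /imsetP[[z x'] pR ->] := Rdom x.
    by exists x'.
  exists (fun x => sval (partner x)) => x y; case: (partner x) => x' /= xR;
    case: (partner y) => y' /= yR.
  - by move/eqP; rewrite -(Req _ _ xR yR) => /eqP.
  - by rewrite -(Redge _ _ xR yR).
pose good n := exists R, [/\ matching R, (x0, x0') \in R & (n <= #|R|)%N].
have good1 : good 1%N.
  exists [set (x0, x0')]; rewrite set11 cards1.
  by split=> //; apply: matching1.
have step n : good n -> (exists2 R, matching R &
    forall x, x \in [set p.1 | p in R]) \/ good n.+1.
  case=> R [mR R0 nR].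
  have [/forallP full|] := boolP [forall x, x \in [set p.1 | p in R]].
    by left; exists R.
  rewrite negb_forall => /existsP[z zN]; right.
  have R01 : x0 \in [set p.1 | p in R] by apply/imsetP; exists (x0, x0').
  have [_ [y [/imsetP[[x x'] xR ->] yN xy]]] := connected_exit connT R01 zN.
  have [y' [y'N x'y' cy]] := unmatched_neighbour cnt mR xR yN xy.
  exists ((y, y') |: R); split.
  - exact: (matching_extend acT acT' mR xR).
  - by rewrite inE R0 orbT.
  - rewrite cardsU1; suff -> : (y, y') \notin R by [].
    by apply: contra yN => yR; apply/imsetP; exists (y, y').
have grow n : (exists2 R, matching R &
    forall x, x \in [set p.1 | p in R]) \/ good n.+1.
  by elim: n => [|n [|/step //]]; [right | left].
case: (grow #|{: T * T'}|) => // -[R [_ _]].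
by rewrite ltnNge max_card.
Qed.

End Matching.

(** * The orbit quotient as a colouring with given local counts *)

Section OrbitColouring.

Local Open Scope ring_scope.

Variable G : sgraph.
Implicit Types (x y : G) (X Y : {set G}).

Lemma orbit_weightE X : orbit_weight X = #|X|%:R.
Proof.
rewrite /orbit_weight mxE -sum1_card natr_sum.
rewrite [RHS]big_mkcond [RHS](reindex _ (onW_bij _ (@enum_val_bij G))) /=.
by apply: eq_bigr => i _; rewrite !mxE; case: (_ \in X); rewrite ?mulr1 ?mulr0.
Qed.

Lemma orbit_formE X Y : orbit_form X Y = \sum_(x in X) #|nbrs x (mem Y)|%:R.
Proof.
rewrite /orbit_form -mulmxA mxE.
rewrite [RHS]big_mkcond [RHS](reindex _ (onW_bij _ (@enum_val_bij G))) /=.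
apply: eq_bigr => i _; rewrite !mxE; case: (_ \in X); rewrite ?mul0r // mul1r.
rewrite -[in RHS]sum1_card natr_sum.
rewrite [RHS]big_mkcond [RHS](reindex _ (onW_bij _ (@enum_val_bij G))) /=.
apply: eq_bigr => j _; rewrite !mxE !inE.
by case: (enum_val j \in Y); case: (edge _ _); rewrite ?mulr1 ?mulr0.
Qed.

Lemma graph_autE (s : {perm G}) x y :
  s \in graph_aut G -> edge (s x) (s y) = edge x y.
Proof. by rewrite inE => /forallP/(_ x)/forallP/(_ y)/eqP. Qed.

(** An automorphism moving x to y carries the neighbours of x to those of y and
    maps every orbit to itself. *)
Lemma orbit_nbrs x y z :
  y \in orbit 'P (graph_aut G) x ->
  #|nbrs y (mem (orbit 'P (graph_aut G) z))| =
  #|nbrs x (mem (orbit 'P (graph_aut G) z))|.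
Proof.
case/orbitP=> s sA <-; rewrite -[RHS](card_imset _ (@perm_inj _ s)).
apply: eq_card => w.
rewrite -(permKV s w) (mem_imset _ _ (@perm_inj _ s)) !inE /= /aperm.
rewrite graph_autE //; congr (_ && _).
by rewrite -[s _]/('P%act _ s) orbit_actr.
Qed.

Lemma orbit_coefE x z :
  orbit_coef (orbit 'P (graph_aut G) x) (orbit 'P (graph_aut G) z) =
  #|nbrs x (mem (orbit 'P (graph_aut G) z))|%:R.
Proof.
rewrite /orbit_coef orbit_formE orbit_weightE.
under eq_bigr => y yx do rewrite (orbit_nbrs _ yx).
rewrite sumr_const -[X in X / _]mulr_natr mulfK // pnatr_eq0 -lt0n.
by apply/card_gt0P; exists x; apply: orbit_refl.
Qed.

Lemma orbit_colouring m (O : 'I_m -> {set G}) : orbit_enumeration O ->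
  exists2 c : G -> 'I_m, forall j, exists x, c x = j &
    forall x j, orbit_coef (O (c x)) (O j) =
                #|nbrs x [pred y | c y == j]|%:R.
Proof.
case=> Oinj Oim.
have colour x : {i | O i == orbit 'P (graph_aut G) x}.
  apply/sigW; have : orbit 'P (graph_aut G) x \in graph_orbits G.
    by apply: imset_f; rewrite inE.
  by rewrite -Oim => /imsetP[i _ ->]; exists i; apply: eqxx.
have Oorb j : exists z, O j = orbit 'P (graph_aut G) z.
  have : O j \in graph_orbits G by rewrite -Oim; apply: imset_f.
  by case/imsetP=> z _ ->; exists z.
have mem_col x j : (sval (colour x) == j) = (x \in O j).
  case: (colour x) => i /= /eqP Oi; have [z Oz] := Oorb j.
  by rewrite -(inj_eq Oinj) Oi Oz; apply/eqP/idP => [<-|/orbit_eqP ->//];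
    apply: orbit_refl.
exists (fun x => sval (colour x)) => [j|x j].
  have [z Oz] := Oorb j; exists z; apply/eqP.
  by rewrite mem_col Oz orbit_refl.
case: (colour x) => i /= /eqP ->; have [z Oz] := Oorb j.
rewrite Oz orbit_coefE; congr (_%:R); apply: eq_card => y.
by rewrite !inE mem_col Oz.
Qed.

End OrbitColouring.

Theorem theorem5p1 (T T' : sgraph) (hT : is_tree T) (hT' : is_tree T')
    (m m' : nat) (O : 'I_m -> {set T}) (O' : 'I_m' -> {set T'})
    (hO : orbit_enumeration O) (hO' : orbit_enumeration O')
    (hm : m = m') (pi : 'S_m)
    (hs : forall i : 'I_m,
        orbit_weight (O' (cast_ord hm (pi i))) = orbit_weight (O i))
    (hb : forall i j : 'I_m,
        orbit_coef (O' (cast_ord hm (pi i))) (O' (cast_ord hm (pi j)))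
        = orbit_coef (O i) (O j)) :
  isomorphic T T'.
Proof.
case: m' / hm O' hO' {hs} hb => O' hO' hb.
have [c _ cE] := orbit_colouring hO.
have [c' c'surj c'E] := orbit_colouring hO'.
have cnt : same_local_counts (fun x => pi (c x)) c'.
  move=> x x' cx j; apply/eqP; rewrite -(eqr_nat rat) -c'E -cx.
  have := hb (c x) (pi^-1%g j); rewrite !cast_ord_id permKV => ->; rewrite cE.
  apply/eqP; congr (_%:R)%R; apply: eq_card => y.
  by rewrite !inE (can2_eq (permK pi) (permKV pi)).
have cnt' : same_local_counts c' (fun x => pi (c x)).
  by move=> x' x cx j; rewrite (cnt x x').
have /card_gt0P[x0 _] := hT.1.1.
have [x0' c0] := c'surj (pi (c x0)).
have [f f_inj f_edge] := tree_embedding hT hT'.2 cnt (esym c0).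
have [g g_inj _] := tree_embedding hT' hT.2 cnt' c0.
by exists f => //; apply: inj_card_bij => //; apply: leq_card g_inj.
Qed.
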